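(* Let $\kappa,\ell\in\mathbb N$, let $h\in\mathcal F(\kappa,\ell)$ be a permutative block code and let $Y\subseteq\mathcal A_\kappa^{\mathbb Z}$ be a minimal subshift. Let $X=\eta_h^{-1}(Y)$. Then the following are equivalent: (i) $(X,\sigma)$ is minimal; (ii) for every word $w\in\mathcal W(Y)$, the return permutation set $\mathcal R(w)$ acts transitively on $\mathcal A_\kappa^{\ell-1}$; (iii) there exists a sequence of words $w^{(n)}\in\mathcal W(Y)$, $n\in\mathbb N$, such that $|w^{(n)}|\to\infty$ as $n\to\infty$ and for all $n\in\mathbb N$ the return permutation set $\mathcal R(w^{(n)})$ acts transitively on $\mathcal A_\kappa^{\ell-1}$; (iv) there exists a sequence of words $w^{(n)}\in\mathcal W(Y)$, $n\in\mathbb N$, such that $w^{(n+1)}$ starts with $w^{(n)}$ for all $n$, $|w^{(n)}|\to\infty$ as $n\to\infty$, and for all $n\in\mathbb N$ the family $\bigcup_{k\ge n}\mathcal R(w^{(k)})$ acts transitively on $\mathcal A_\kappa^{\ell-1}$.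
   Context: $\mathbb N=\{1,2,\dots\}$, $\mathcal A_\kappa=\{0,\dots,\kappa-1\}$, and $\mathcal A_\kappa^*$ is the set of finite words (including the empty word); $|w|$ is the length of $w=w_0\ldots w_{|w|-1}$ and $x_{[k,n]}=x_k\ldots x_n$. $\mathcal A_\kappa^{\mathbb Z}$ carries the product topology; $\sigma$ is the left shift, $\sigma(x)_n=x_{n+1}$. A subshift is a closed $\sigma$-invariant subset of $\mathcal A_\kappa^{\mathbb Z}$, and $\mathcal W(Y)$ is the set of all finite words occurring in sequences of $Y$. A (nonempty) system is minimal if all its orbits are dense. A block code of length $\ell$ is a map $h:\mathcal A_\kappa^\ell\to\mathcal A_\kappa$; the set of these is $\mathcal F(\kappa,\ell)$. The sliding block code $\eta_h:\mathcal A_\kappa^{\mathbb Z}\to\mathcal A_\kappa^{\mathbb Z}$ is $\eta_h(x)_n=h(x_{[n,n+\ell-1]})$. $h$ is permutative if for every $u\in\mathcal A_\kappa^{\ell-1}$ both maps $a\mapsto h(ua)$ and $a\mapsto h(au)$ are permutations of $\mathcal A_\kappa$. For permutative $h$, $w\in\mathcal A_\kappa^*$ and $u\in\mathcal A_\kappa^{\ell-1}$, there is a unique word $\xi^u(w)\in\mathcal A_\kappa^{|w|+\ell-1}$ starting with $u$ and satisfying $h(\xi^u(w)_{[n,n+\ell-1]})=w_n$ for $0\le n\le|w|-1$; the prefix permutation $\Phi_w$ of $\mathcal A_\kappa^{\ell-1}$ sends $u$ to the last $\ell-1$ letters of $\xi^u(w)$. The set of return permutations of $w$ is $\mathcal R(w)=\mathcal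 R^Y_h(w)=\{\Phi_{wv}\mid v\in\mathcal A_\kappa^*,\ wvw\in\mathcal W(Y)\}$. A set $P$ of permutations of $\mathcal A_\kappa^{\ell-1}$ is said to act transitively if the group $\langle P\rangle$ generated by $P$ acts transitively on $\mathcal A_\kappa^{\ell-1}$. *)

(* Defs.v *)
From HB Require Import structures.
From mathcomp Require Import all_boot ssralg ssrint fingroup perm action.
From mathcomp Require Import all_classical topology.

Set Implicit Arguments.
Unset Strict Implicit.
Unset Printing Implicit Defensive.

Import GRing.Theory.

Local Open Scope classical_set_scope.

(* kappa^Z with the product topology of the discrete alphabet 'I_kappa. *)
Notation fullshift kappa :=
  (prod_topology (fun _ : int => discrete_topology 'I_kappa)).

Section Subshifts.
Variable kappa : nat.
Implicit Types (x : fullshift kappa) (Y : set (fullshift kappa)).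

Definition shift x : fullshift kappa := fun n : int => x (n + 1)%R.

(* The k-th iterate of the homeomorphism [shift], for any integer k. *)
Definition shift_iter (k : int) x : fullshift kappa :=
  fun n : int => x (n + k)%R.

Definition shift_orbit x : set (fullshift kappa) :=
  range (fun k : int => shift_iter k x).

Definition subshift Y : Prop := closed Y /\ shift @` Y = Y.

Definition minimal Y : Prop :=
  Y !=set0 /\ forall x, Y x -> Y `<=` closure (shift_orbit x).

(* The word x_k x_(k+1) ... x_(k+n-1). *)
Definition subword x (k : int) (n : nat) : seq 'I_kappa :=
  mkseq (fun i => x (k + i%:Z)%R) n.

Definition language Y : set (seq 'I_kappa) :=
  [set w | exists x, exists k, Y x /\ w = subword x k (size w)].

End Subshifts.

Definition block_code (kappa l : nat) := l.-tuple 'I_kappa -> 'I_kappa.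

Definition sliding_block_code (kappa l : nat) (h : block_code kappa l)
    (x : fullshift kappa) : fullshift kappa :=
  fun n : int => h [tuple x (n + (i : nat)%:Z)%R | i < l].

(* From here on the length of a block code is m.+1, so that m is the length
   minus one, the length of the words that are permuted. *)
Section Permutative.
Variables (kappa m : nat).
Implicit Types (h : block_code kappa m.+1) (w : seq 'I_kappa).
Implicit Types (u : m.-tuple 'I_kappa).

Definition permutative h : Prop :=
  forall u, bijective (fun a => h [tuple of rcons u a]) /\
            bijective (fun a => h [tuple of a :: u]).

Lemma window_subproof s (n : 'I_s) (i : 'I_m.+1) : (n + i < s + m)%N.
Proof. by rewrite -addSn leq_add // -ltnS. Qed.

(* The factor v_n ... v_(n+m) of a word v of length s + m. *)
Definition window s (v : (s + m).-tuple 'I_kappa) (n : 'I_s) :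
    m.+1.-tuple 'I_kappa :=
  [tuple tnth v (Ordinal (window_subproof n i)) | i < m.+1].

(* v starts with u and is mapped to w by h. *)
Definition is_xi h u w (v : (size w + m).-tuple 'I_kappa) : bool :=
  (take m v == u :> seq 'I_kappa) &&
  [forall n : 'I_(size w), h (window v n) == tnth (in_tuple w) n].

Arguments is_xi : clear implicits.

Lemma val_window s (v : (s + m).-tuple 'I_kappa) (n : 'I_s) :
  window v n = take m.+1 (drop n v) :> seq 'I_kappa.
Proof.
have s0 : 'I_kappa by exact: (tnth v (Ordinal (window_subproof n ord0))).
apply: (@eq_from_nth _ s0) => [|i].
  rewrite size_tuple size_takel // size_drop size_tuple ltn_subRL.
  by rewrite -addSn leq_add.
rewrite size_tuple => im; rewrite nth_take // nth_drop.
by rewrite -[i]/(nat_of_ord (Ordinal im)) -tnth_nth tnth_mktuple (tnth_nth s0).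
Qed.

Lemma take_cons_take (c : 'I_kappa) (s : seq 'I_kappa) :
  take m (c :: s) = take m (c :: take m s).
Proof. by case: m => //= n; rewrite take_takel. Qed.

Lemma is_xi_cons h u a w c (v : (size w + m).-tuple 'I_kappa) :
  is_xi h u (a :: w) [tuple of c :: v] <->
  [/\ take m (c :: v) = u, exists2 t, c :: take m v = tval t & h t = a &
   exists2 u' : m.-tuple 'I_kappa, take m v = u' & is_xi h u' w v].
Proof.
have stake : size (take m v) == m by rewrite size_takel // size_tuple leq_addl.
have w0 : tval (window (s := (size w).+1) [tuple of c :: v] ord0) = c :: take m v.
  by rewrite val_window.
have wS n : window (s := (size w).+1) [tuple of c :: v] (lift ord0 n) = window v n.
  by apply: val_inj; rewrite [LHS]val_window [RHS]val_window.
split=> [/andP[/eqP tu /forallP hv]|[tu [t tE ht] [u' tu' /andP[_ /forallP hv]]]].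
  split=> //.
    exists (window (s := (size w).+1) [tuple of c :: v] ord0) => //.
    by have /eqP -> := hv ord0.
  exists (Tuple stake) => //; apply/andP; split=> //; apply/forallP => n.
  by have := hv (lift ord0 n); rewrite wS !(tnth_nth a).
rewrite /is_xi; apply/andP; split; first exact/eqP.
apply/forallP => n; case: (unliftP ord0 n) => [j|] ->.
  by have := hv j; rewrite wS !(tnth_nth a).
have -> : window (s := (size w).+1) [tuple of c :: v] ord0 = t.
  by apply: val_inj; exact: etrans w0 tE.
by rewrite ht.
Qed.

Lemma xi_subproof h (hp : permutative h) u w : exists v, is_xi h u w v.
Proof.
elim: w u => [|a w IHw] u.
  by exists u; rewrite /is_xi take_oversize ?size_tuple // eqxx; apply/forallP => -[].
have [[g _ hg] _] := hp u.
have tE := hg a.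
set t := [tuple of rcons u (g a)] in tE.
have [v vP] := IHw [tuple of behead t].
exists [tuple of thead t :: v]; have /andP[/eqP tv _] := vP.
have tt : thead t :: take m v = tval t.
  by rewrite tv -[RHS]/(tval t) [in RHS](tuple_eta t).
apply/is_xi_cons; split; [|by exists t|by exists [tuple of behead t]].
by rewrite take_cons_take tt /= -cats1 take_size_cat // size_tuple.
Qed.

Lemma xi_unique h (hp : permutative h) u w v1 v2 :
  is_xi h u w v1 -> is_xi h u w v2 -> v1 = v2.
Proof.
elim: w u v1 v2 => [|a w IHw] u v1 v2.
  move=> /andP[/eqP + _] /andP[/eqP + _].
  rewrite !take_oversize ?size_tuple // => e1 e2.
  exact/val_inj/(etrans e1 (esym e2)).
case/tupleP: v1 => c1 v1; case/tupleP: v2 => c2 v2.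
move=> /is_xi_cons[tu1 [t1 t1E ht1] [u1 tu1' x1]].
move=> /is_xi_cons[tu2 [t2 t2E ht2] [u2 tu2' x2]].
have tr (c : 'I_kappa) (v : (size w + m).-tuple 'I_kappa) (t : m.+1.-tuple 'I_kappa) :
    take m (c :: v) = u -> c :: take m v = tval t ->
    t = [tuple of rcons u (tnth t ord_max)].
  move=> tu tE; apply: val_inj => /=.
  have -> : tval u = take m t.
    by rewrite -tE -take_cons_take.
  rewrite (tnth_nth c) /= -take_nth ?size_tuple //.
  by rewrite take_oversize ?size_tuple.
have [[g hg _] _] := hp u.
have tt : t1 = t2.
  move: ht1; rewrite -ht2 (tr _ _ _ tu1 t1E) (tr _ _ _ tu2 t2E).
  by move=> /(can_inj hg) ->.
have [cc uu] : c1 = c2 /\ take m v1 = take m v2.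
  by move: t1E; rewrite tt -t2E => -[].
have u12 : u1 = u2 by apply: val_inj; rewrite /= -tu1' -tu2'.
subst c2 u2; by rewrite (IHw _ _ _ x1 x2).
Qed.

(* By [xi_unique], this is the only word satisfying [is_xi h u w]. *)
Definition xi h (hp : permutative h) u w : (size w + m).-tuple 'I_kappa :=
  xchoose (xi_subproof hp u w).

Lemma xiP h (hp : permutative h) u w : is_xi h u w (xi hp u w).
Proof. exact: xchooseP. Qed.

Lemma last_letters_subproof s (v : (s + m).-tuple 'I_kappa) : size (drop s v) == m.
Proof. by rewrite size_drop size_tuple addKn. Qed.

(* The last m letters of a word of length s + m. *)
Definition last_letters s (v : (s + m).-tuple 'I_kappa) : m.-tuple 'I_kappa :=
  Tuple (last_letters_subproof v).

Definition prefix_map h (hp : permutative h) w u : m.-tuple 'I_kappa :=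
  last_letters (xi hp u w).

Lemma prefix_map_inj h (hp : permutative h) w : injective (prefix_map hp w).
Proof.
have suff_inj u1 u2 w' v1 v2 : is_xi h u1 w' v1 -> is_xi h u2 w' v2 ->
    drop (size w') v1 = drop (size w') v2 -> v1 = v2.
  elim: w' u1 u2 v1 v2 => [|a w' IHw] u1 u2 v1 v2.
    by move=> _ _; rewrite !drop0 => /val_inj.
  case/tupleP: v1 => c1 v1; case/tupleP: v2 => c2 v2.
  move=> /is_xi_cons[_ [t1 t1E ht1] [v1' v1E x1]].
  move=> /is_xi_cons[_ [t2 t2E ht2] [v2' v2E x2]] /= /(IHw _ _ _ _ x1 x2) vv.
  subst v2; suff -> : c1 = c2 by [].
  have [_ [g hg _]] := hp v1'; apply: (can_inj hg) => /=.
  have -> : [tuple of c1 :: v1'] = t1 by apply: val_inj; rewrite /= -v1E.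
  have -> : [tuple of c2 :: v1'] = t2 by apply: val_inj; rewrite /= -v1E.
  by rewrite ht1.
move=> u1 u2 /(congr1 val) /(suff_inj _ _ _ _ _ (xiP hp u1 w) (xiP hp u2 w)).
have /andP[/eqP e1 _] := xiP hp u1 w; have /andP[/eqP e2 _] := xiP hp u2 w.
by move=> e; apply: val_inj; rewrite /= -e1 -e2 e.
Qed.

Definition prefix_perm h (hp : permutative h) w : {perm m.-tuple 'I_kappa} :=
  perm (@prefix_map_inj h hp w).

Definition return_perms h (hp : permutative h) (Y : set (fullshift kappa)) w :
    set {perm m.-tuple 'I_kappa} :=
  [set p | exists2 v, language Y (w ++ v ++ w) & p = prefix_perm hp (w ++ v)].

End Permutative.

(* [<<_>>] is the generated subgroup of {perm T} and 'P its natural action;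
   P, a classical set, is first turned into a finite set. *)
Definition acts_transitively (T : finType) (P : set {perm T}) : Prop :=
  [transitive <<finset (fun p => p \in P)>>, on [set: T]%SET | 'P].

(* Main.v *)
Require Import Defs.
From HB Require Import structures.
From mathcomp Require Import all_boot ssralg ssrint fingroup perm action.
From mathcomp Require Import all_classical topology.
From mathcomp Require Import zify.

Set Implicit Arguments.
Unset Strict Implicit.
Unset Printing Implicit Defensive.

Import GRing.Theory.

Local Open Scope classical_set_scope.

(** Write [eta] for the sliding block code of [h] and [X] for the preimage of
    [Y] under [eta], and call the word x_k ... x_(k+m-1) the state of x at
    position k.  As [h] is permutative, a point of [X] is determined by its image
    together with its state at one position, every such pair is realised
    ([sliding_block_code_lift]), and reading the word w in the image changes the
    state by the prefix permutation of w ([prefix_perm_subword]).  So [X] is a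
    skew product over [Y] with the finite fibre of states, and the theorem says
    when this skew product is minimal.

    Transitivity of a set of permutations is used in the form of
    [acts_transitivelyP]: every nonempty set of states that the permutations map
    into itself contains all states.

    Minimality gives transitivity for every word: over an occurrence of w, lift a
    point of [Y] to two points of [X] with prescribed states s and t.  By uniform
    recurrence in [X], the local pattern of the second point occurs in the first
    one, to the right of w; the word read until then is wv for a return wvw, and
    its permutation sends s to t ([minimal_transitive]).

    Transitivity along words of unbounded length gives transitivity for every
    word: if w is a factor of w', then the return permutations of w' are, up to
    conjugation by a prefix permutation, return permutations of w
    ([return_perms_infix]), and by uniform recurrence in [Y] every w is a factor
    of all long words.  The prefixes of a one-sided point then form a nested
    sequence of words.

    Transitivity along nested words gives minimality: fix x in [X] and attach to
    each word w the set T(w) of the states of x at the occurrences of w in its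
    image.  The size of T(w) can only decrease when w is extended to the left or
    to the right, so it is constant on the words that contain a word w0 with
    T(w0) of least size, in particular on all long words of the sequence.
    Constancy forces T to be the same set S for all these nested words, and it
    forces each of their return permutations to preserve S.  By transitivity S
    contains all states; as its size is the least one, every T(w) contains all
    states.  Hence every pattern of [X] occurs in x ([nested_minimal]). *)

(** * Words, cylinders and uniform recurrence *)

Section Recurrence.
Variable kappa : nat.
Implicit Types (x y z : fullshift kappa) (Z : set (fullshift kappa)).
Implicit Types (w : seq 'I_kappa).
Implicit Types (j k : int).

Lemma eq_subwordP x y j k n :
  subword x j n = subword y k n <->
  forall i : nat, (i < n)%N -> x (j + i%:Z)%R = y (k + i%:Z)%R.
Proof.
split=> [e i lt_in|e].
  have := congr1 (fun s => nth (x (j + i%:Z)%R) s i) e.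
  by rewrite !nth_mkseq.
apply: (@eq_from_nth _ (x j)); rewrite !size_mkseq // => i lt_in.
by rewrite !nth_mkseq ?e.
Qed.

Lemma subword_cat x k n1 n2 :
  subword x k (n1 + n2) = subword x k n1 ++ subword x (k + n1%:Z)%R n2.
Proof.
rewrite /subword /mkseq iotaD map_cat; congr cat.
rewrite add0n -[n1]addn0 iotaDl -map_comp addn0; apply: eq_map => i /=.
by congr x; lia.
Qed.

Lemma eq_subword_le x z j k n1 n2 :
  subword x j (n1 + n2) = subword z k (n1 + n2) ->
  subword x j n1 = subword z k n1.
Proof.
by rewrite !subword_cat => /eqP; rewrite eqseq_cat ?size_mkseq // => /andP[/eqP].
Qed.

Lemma subword_shift x j k n :
  subword (shift_iter j x) k n = subword x (k + j)%R n.
Proof. by apply/eq_subwordP => i _; rewrite /shift_iter; congr x; lia. Qed.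

Lemma language_infix Z w1 w2 w3 :
  language Z (w1 ++ w2 ++ w3) -> language Z w2.
Proof.
move=> [x [k [Zx]]]; rewrite !size_cat !subword_cat => /eqP.
rewrite !eqseq_cat ?size_mkseq // => /andP[_ /andP[/eqP e _]].
by exists x, (k + size w1)%R.
Qed.

Lemma language_subword Z x k n : Z x -> language Z (subword x k n).
Proof. by move=> Zx; exists x, k; rewrite size_mkseq. Qed.

Definition shift_invariant Z := forall k x, Z x -> Z (shift_iter k x).

Lemma subshift_invariant Z : @shift kappa @` Z = Z -> shift_invariant Z.
Proof.
move=> eZ; have fwd n x : Z x -> Z (shift_iter n%:Z x).
  elim: n x => [|n IHn] x Zx.
    by have <- : x = shift_iter 0 x by apply/funext => i; rewrite /shift_iter addr0.
  have -> : shift_iter n.+1 x = shift_iter n (@shift kappa x).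
    by apply/funext => i; rewrite /shift_iter /shift; congr x; lia.
  by apply: IHn; rewrite -eZ; exists x.
have bwd n x : Z x -> Z (shift_iter (- n%:Z)%R x).
  elim: n x => [|n IHn] x Zx; first exact: (fwd 0%N).
  rewrite -eZ in Zx; case: Zx => y Zy <-.
  have -> : shift_iter (- n.+1%:Z)%R (@shift kappa y) = shift_iter (- n%:Z)%R y.
    by apply/funext => i; rewrite /shift_iter /shift; congr y; lia.
  exact: IHn.
by move=> [n|n] x Zx; [exact: fwd|rewrite NegzE; exact: bwd].
Qed.

Lemma nbhs_cylinder x k n : nbhs x [set z | subword z k n = subword x k n].
Proof.
elim: n => [|n IHn]; first by apply: filterS filterT => z _.
have : nbhs x [set z | z (k + n%:Z)%R = x (k + n%:Z)%R].
  apply: (@proj_continuous int (fun=> discrete_topology 'I_kappa) (k + n%:Z)%R x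
           [set x (k + n%:Z)%R]).
  apply: open_nbhs_nbhs; split => //; exact: discrete_open.
apply: filterS2 IHn => z /= e1 e2.
apply/eq_subwordP => i; rewrite ltnS leq_eqVlt => /predU1P[-> //|].
by move/eq_subwordP: e1; apply.
Qed.

(** Cylinders form a base of the product topology: the filter that they generate
    converges to x coordinatewise, hence contains all neighbourhoods of x. *)
Lemma nbhs_cylinderP x (A : set (fullshift kappa)) :
  nbhs x A -> exists k n, [set z | subword z k n = subword x k n] `<=` A.
Proof.
(* Symmetric windows make the family of cylinders visibly directed. *)
pose F := [set B : set (fullshift kappa) | exists N : nat,
  forall z, (forall i : int, (`|i| <= N)%N -> z i = x i) -> B z].
have FF : Filter F.
  split; first by exists 0%N.
  - move=> B C [N hB] [M hC]; exists (maxn N M) => z hz.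
    by split; [apply: hB|apply: hC] => i hi; apply: hz; lia.
  - by move=> B C BC [N hB]; exists N => z /hB /BC.
have : nbhs x `<=` F.
  apply/cvg_sup => i B [_ [[C _ <-] Cx CB]].
  by exists `|i|%N => z hz; apply: CB; rewrite /= hz.
move=> /(_ A) + nA => /(_ nA) [N hN].
exists (- N%:Z)%R, (N + N).+1 => z /eq_subwordP e; apply: hN => i hi.
have := e (absz (i + N%:Z)%R).
have -> : (- N%:Z + (absz (i + N%:Z))%:Z = i)%R by lia.
by apply; lia.
Qed.

Lemma in_closure_orbit x z :
  closure (shift_orbit z) x <->
  forall k n, exists j, subword z j n = subword x k n.
Proof.
split=> [cx k n|e A /nbhs_cylinderP[k [n kA]]].
  have [_ [[j _ <-] /=]] := cx _ (nbhs_cylinder x k n).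
  by rewrite subword_shift; exists (k + j)%R.
have [j ej] := e k n; exists (shift_iter (j - k)%R z).
split; first by exists (j - k)%R.
by apply: kA; rewrite /= subword_shift -ej; congr subword; lia.
Qed.

(** A word of a minimal subshift occurs in every point with bounded gaps.  Each
    orbit is dense, so w occurs somewhere in each point, and the position can be
    kept the same on a neighbourhood; compactness bounds these positions. *)
Lemma uniform_recurrence Z w : closed Z ->
  shift_invariant Z -> minimal Z ->
  language Z w ->
  exists N, forall x k, Z x ->
    exists2 i, (i < N)%N & subword x (k + i%:Z)%R (size w) = w.
Proof.
move=> cZ iZ [_ mZ] [y [k0 [Zy ew]]].
have cpt : compact Z.
  apply: (subclosed_compact cZ) (@subsetT _ _).
  have -> : [set: fullshift kappa] = [set f | forall i, [set: 'I_kappa] (f i)].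
    exact/esym/seteqP.
  apply: (@tychonoff int (fun=> discrete_topology 'I_kappa) (fun=> setT)) => _.
  exact/finite_compact/finite_finset.
pose P N x := exists2 k : int, (`|k| < N)%N & subword x k (size w) = w.
have [] : \forall N \near \oo, Z `<=` P N.
  apply: (iffLR (compact_near_coveringP Z) cpt) => x Zx.
  have /in_closure_orbit /(_ k0 (size w))[j ej] := mZ x Zx y Zy.
  exists ([set z | subword z j (size w) = subword x j (size w)],
          [set N | (`|j| < N)%N]).
    split => /=; first exact: nbhs_cylinder.
    by exists `|j|.+1.
  by move=> [z N] /= [ez jN]; exists j; rewrite // ez ej -ew.
move=> N _ /(_ N (leqnn N)) hN.
(* Centring at k + N turns a position in ]-N, N[ into a nonnegative offset. *)
exists (N + N)%N => x k Zx.
have [j jN] := hN (shift_iter (k + N%:Z)%R x) (iZ _ _ Zx).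
rewrite subword_shift => e; exists (absz (j + N%:Z)%R); first by lia.
by rewrite -[RHS]e; congr subword; lia.
Qed.
End Recurrence.

(** * States of a permutative block code *)

Section States.
Variables (kappa m : nat) (h : block_code kappa m.+1) (hp : permutative h).
Implicit Types (x y z : fullshift kappa) (w v : seq 'I_kappa).
Implicit Types (u : m.-tuple 'I_kappa).
Implicit Types (j k : int).

Local Notation eta := (sliding_block_code h).

Definition state x k : m.-tuple 'I_kappa := [tuple x (k + (i : nat)%:Z)%R | i < m].

Lemma val_state x k : state x k = subword x k m :> seq 'I_kappa.
Proof.
apply: (@eq_from_nth _ (x 0%R)); rewrite ?size_tuple ?size_mkseq // => i im.
by rewrite nth_mkseq // -[i]/(nat_of_ord (Ordinal im)) -tnth_nth tnth_mktuple.
Qed.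

Lemma sliding_block_code_shift k x : eta (shift_iter k x) = shift_iter k (eta x).
Proof.
apply/funext => n; rewrite /sliding_block_code /shift_iter; congr h.
by apply: eq_from_tnth => i; rewrite !tnth_mktuple; congr x; lia.
Qed.

Lemma xi_subword x k n :
  xi hp (state x k) (subword (eta x) k n) = subword x k (n + m) :> seq 'I_kappa.
Proof.
set w := subword (eta x) k n.
have sw : size w = n by rewrite size_mkseq.
have sv : size (subword x k (n + m)) == (size w + m)%N by rewrite size_mkseq sw.
suff e : @is_xi _ _ h (state x k) w (Tuple sv).
  by rewrite (xi_unique hp (xiP hp (state x k) w) e).
apply/andP; split.
  by rewrite /= addnC subword_cat take_size_cat ?size_mkseq // val_state.
apply/forallP => i; apply/eqP; rewrite (tnth_nth (eta x 0%R)) /=.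
have lt_in : (i < n)%N by rewrite -[n in leqRHS]sw.
rewrite nth_mkseq // /sliding_block_code; congr h.
apply: eq_from_tnth => j; rewrite !tnth_mktuple (tnth_nth (x 0%R)) /= nth_mkseq.
  by congr x; lia.
by have := ltn_ord j; lia.
Qed.

(** The cocycle identity: prefix permutations describe how states evolve. *)
Lemma prefix_perm_subword x k n :
  prefix_perm hp (subword (eta x) k n) (state x k) = state x (k + n%:Z)%R.
Proof.
apply: val_inj; rewrite permE /= xi_subword size_mkseq subword_cat.
by rewrite drop_size_cat ?size_mkseq // val_state.
Qed.

Lemma eq_subword_state x z j k n :
  subword (eta x) j n = subword (eta z) k n -> state x j = state z k ->
  subword x j (n + m) = subword z k (n + m).
Proof. by move=> ew eu; rewrite -!xi_subword ew eu. Qed.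

Lemma subword_eta x z j k n :
  subword x j (n + m) = subword z k (n + m) ->
  subword (eta x) j n = subword (eta z) k n.
Proof.
move/eq_subwordP => e; apply/eq_subwordP => i lt_in; congr h.
apply: eq_from_tnth => l; rewrite !tnth_mktuple -!addrA -!PoszD; apply: e.
by have := ltn_ord l; lia.
Qed.

(** Invertibility makes it possible to run time backwards as well, which gives a
    two-sided orbit of a nonautonomous sequence of permutations. *)
Lemma perm_orbitZ (T : finType) (p : int -> {perm T}) (t : T) :
  exists s : int -> T, s 0%R = t /\ forall k, s (k + 1)%R = p k (s k).
Proof.
pose f := fix f n := if n is n'.+1 then p n' (f n') else t.
pose b := fix b n := ((p (Negz n))^-1)%g (if n is n'.+1 then b n' else t).
exists (fun k => match k with Posz n => f n | Negz n => b n end); split => //.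
case=> [n|[|n]]; first by rewrite -PoszD addn1.
  by rewrite /= permKV.
have -> : (Negz n.+1 + 1 = Negz n)%R by lia.
by rewrite /= permKV.
Qed.

(** The states of the lift are the two-sided orbit of u under the permutations
    of the single letters of y, and the overlaps of consecutive windows of length
    m+1 are these states, so that the windows glue to one point. *)
Lemma sliding_block_code_lift y u : exists x, eta x = y /\ state x 0%R = u.
Proof.
have [s [s0 sS]] := perm_orbitZ (fun k => prefix_perm hp [:: y k]) u.
pose W k : m.+1.-tuple 'I_kappa := xi hp (s k) [:: y k].
have W_take k : take m (W k) = s k.
  by have /andP[/eqP] := xiP hp (s k) [:: y k].
have W_behead k : behead (W k) = s (k + 1)%R.
  by rewrite sS permE /= drop1.
have hW k : h (W k) = y k.
  have /andP[_ /forallP/(_ ord0)/eqP] := xiP hp (s k) [:: y k].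
  rewrite (tnth_nth (y k)) => e; apply: etrans e; congr h.
  apply: val_inj; rewrite [RHS]val_window drop0 take_oversize //.
  by rewrite size_tuple.
(* The first letter of the window, as states have no letter when m = 0. *)
pose x : fullshift kappa := fun k => thead (W k).
have nthW i k : (i < m.+1)%N -> nth (y k) (W k) i = x (k + i%:Z)%R.
  elim: i k => [|i IHi] k im; first by rewrite addr0 /x /thead (tnth_nth (y k)).
  rewrite -nth_behead W_behead -W_take nth_take //.
  rewrite (set_nth_default (y (k + 1)%R)) ?size_tuple; last exact: ltnW.
  by rewrite IHi; [congr x; lia|exact: ltnW].
exists x; split.
  apply/funext => k; rewrite /sliding_block_code -hW; congr h.
  by apply: eq_from_tnth => i; rewrite tnth_mktuple (tnth_nth (y k)) nthW.
apply: eq_from_tnth => i; rewrite tnth_mktuple -s0 (tnth_nth (y 0%R)).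
by rewrite -W_take nth_take // nthW // ltnW // ltnS.
Qed.

Lemma prefix_perm_nil u : prefix_perm hp [::] u = u.
Proof.
apply: val_inj; rewrite permE /= drop0.
by have /andP[/eqP <- _] := xiP hp u [::]; rewrite take_oversize // size_tuple.
Qed.

(** The word w ++ v is read in the image of some point with state u, and there
    the composition law is the additivity of positions. *)
Lemma prefix_perm_cat w v u :
  prefix_perm hp (w ++ v) u = prefix_perm hp v (prefix_perm hp w u).
Proof.
case e : (w ++ v) => [|a t].
  by move: e; case: w v => [|? ?] [|? ?] // _; rewrite !prefix_perm_nil.
have [x [ex <-]] := sliding_block_code_lift (fun k => nth a (w ++ v) `|k|%N) u.
rewrite -e; have {}e : subword (eta x) 0%R (size w + size v) = w ++ v.
  apply: (@eq_from_nth _ a); rewrite size_mkseq ?size_cat // => i lt_i.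
  by rewrite nth_mkseq // ex add0r.
have /andP[/eqP ew /eqP ev] :
    (subword (eta x) 0%R (size w) == w) &&
    (subword (eta x) (0 + (size w)%:Z)%R (size v) == v).
  by rewrite -eqseq_cat ?size_mkseq // -e subword_cat.
have := prefix_perm_subword x 0%R (size w + size v).
have := prefix_perm_subword x (0 + (size w)%:Z)%R (size v).
have := prefix_perm_subword x 0%R (size w).
by rewrite ew ev e => -> -> ->; rewrite PoszD addrA.
Qed.
End States.

(** * Transitivity in terms of invariant sets *)

Section Transitivity.
Variables (T : finType).
Implicit Types (P : set {perm T}).

(** The orbits of the generated group are the minimal nonempty invariant sets; a
    set mapped into itself by a permutation of a finite type is mapped onto
    itself, so that no inverses have to be mentioned. *)
Lemma acts_transitivelyP P (t0 : T) :
  acts_transitively P <->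
  forall S : {set T}, (exists t, t \in S) ->
    (forall p t, P p -> t \in S -> p t \in S) -> forall t, t \in S.
Proof.
rewrite /acts_transitively; set G := <<_>>%g; split.
  move=> trG S [s sS] PS t.
  have actG : [acts G, on S | 'P].
    rewrite gen_subG; apply/fintype.subsetP => p; rewrite inE => /set_mem Pp.
    apply/astabsP => x; apply/idP/idP => [|xS]; last exact: PS.
    have imS : [set p y | y in S]%SET = S.
      apply/eqP; rewrite eqEcard card_imset ?leqnn ?andbT; last exact: perm_inj.
      by apply/fintype.subsetP => _ /imsetP[y yS ->]; apply: PS.
    by rewrite -{1}imS => /imsetP[y yS /perm_inj ->].
  have /fintype.subsetP := acts_sub_orbit s actG; rewrite sS => /(_ t); apply.
  by rewrite (atransP trG) ?inE.
move=> inv; apply/imsetP; exists t0; rewrite ?inE //.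
apply/setP => t; rewrite !inE.
apply/esym/inv; first by exists t0; exact: orbit_refl.
move=> p s Pp /orbitP[g Gg <-]; apply/orbitP; exists (g * p)%g; last first.
  by rewrite /= apermE permM.
by rewrite groupM // mem_gen // inE; apply/mem_set.
Qed.

End Transitivity.

(** * Minimality and return permutations *)

Section ReturnPermutations.
Variables (kappa m : nat) (h : block_code kappa m.+1) (hp : permutative h).
Variables (Y : set (fullshift kappa)) (Ysub : subshift Y) (Ymin : minimal Y).
Implicit Types (x y z : fullshift kappa) (w v : seq 'I_kappa).
Implicit Types (u : m.-tuple 'I_kappa).
Implicit Types (j k : int).

Local Notation eta := (sliding_block_code h).
Local Notation X := (eta @^-1` Y).

Lemma acts_transitively_sub (P Q : set {perm m.-tuple 'I_kappa}) u :
  P `<=` Q -> acts_transitively P -> acts_transitively Q.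
Proof.
move=> PQ /(acts_transitivelyP _ u) trP; apply/(acts_transitivelyP _ u) => S S0 QS.
by apply: trP => // p t /PQ; apply: QS.
Qed.

(** For a return w1 w w2 v w1 w w2 of the long word, w w2 v w1 w is a return of
    w, and the two permutations are conjugate by the prefix permutation of w1.
    Accordingly, a set S invariant for w is pulled back along that permutation to
    a set invariant for the long word. *)
Lemma return_perms_infix w1 w w2 u :
  acts_transitively (return_perms hp Y (w1 ++ w ++ w2)) ->
  acts_transitively (return_perms hp Y w).
Proof.
move/(acts_transitivelyP _ u) => tr; apply/(acts_transitivelyP _ u) => S [s sS] RS t.
pose a := prefix_perm hp w1.
have : (a^-1%g t) \in [set t | a t \in S]%SET.
  apply: tr.
    by exists (a^-1%g s); rewrite inE permKV.
  move=> _ r [v Lv ->]; rewrite !inE => rS.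
  have := RS (prefix_perm hp (w ++ (w2 ++ v ++ w1))) (a r).
  rewrite /a -!prefix_perm_cat !catA; apply=> //.
  exists (w2 ++ v ++ w1); last by rewrite !catA.
  apply: (@language_infix _ _ w1 _ w2).
  by move: Lv; rewrite !catA.
by rewrite inE permKV.
Qed.

Lemma closed_preimage : closed X.
Proof.
move=> x cx; apply: Ysub.1 => A /nbhs_cylinderP[k [n kA]].
have [z [Xz ez]] := cx _ (nbhs_cylinder x k (n + m)).
by exists (eta z); split=> //; apply/kA/subword_eta.
Qed.

Lemma preimage_invariant : shift_invariant X.
Proof.
move=> k x Xx; rewrite /preimage /= sliding_block_code_shift.
exact: subshift_invariant Ysub.2 _ _ Xx.
Qed.

Lemma language_occurrence w y : language Y w -> Y y ->
  exists k, subword y k (size w) = w.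
Proof.
move=> [y' [k' [Yy' ew]]] Yy.
by have /in_closure_orbit/(_ k' (size w)) := Ymin.2 y Yy y' Yy'; rewrite -ew.
Qed.

(** Recurrence is used to the right of the whole word w, so that the occurrence
    found does not overlap w and yields a return of the form wvw. *)
Lemma minimal_transitive w : minimal X -> language Y w ->
  acts_transitively (return_perms hp Y w).
Proof.
move=> Xmin [y [k [Yy ew]]]; have [x0 _] := Xmin.1.
apply/(acts_transitivelyP _ (state m x0 0%R)) => S [s sS] RS t.
have [x [ex sx]] := sliding_block_code_lift hp (shift_iter k y) s.
have [z [ez sz]] := sliding_block_code_lift hp (shift_iter k y) t.
have Yky : Y (shift_iter k y) by exact: subshift_invariant Ysub.2 _ _ Yy.
have Xx : X x by rewrite /preimage /= ex.
have Xz : X z by rewrite /preimage /= ez.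
have ewz : subword (eta z) 0%R (size w) = w by rewrite ez subword_shift add0r.
have ewx : subword (eta x) 0%R (size w) = w by rewrite ex subword_shift add0r.
have [N hN] := uniform_recurrence closed_preimage preimage_invariant Xmin
  (language_subword 0%R (size w + m) Xz).
have [i _] := hN x (size w) Xx; rewrite size_mkseq => ei.
have sj : state m x ((size w)%:Z + i%:Z)%R = t.
  by rewrite -sz; apply: val_inj; move: ei; rewrite /= !val_state addnC;
    exact: eq_subword_le.
have ewj := subword_eta h ei; rewrite ewz in ewj.
have ewv : subword (eta x) 0%R (size w + i) = w ++ subword (eta x) (size w) i.
  by rewrite subword_cat ewx add0r.
have := RS (prefix_perm hp (w ++ subword (eta x) (size w) i)) s.
rewrite -ewv -sx prefix_perm_subword add0r PoszD sj sx; apply=> //.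
exists (subword (eta x) (size w) i); last by rewrite ewv.
rewrite catA -ewv -[X in _ ++ X]ewj -PoszD -[Posz _]add0r -subword_cat.
by apply: language_subword; rewrite ex.
Qed.

(** * Minimality from nested words *)

(** The fibre, over the occurrences of w, of the orbit of x in the skew product. *)
Definition occurring_states x w : {set m.-tuple 'I_kappa} :=
  [set u | `[< exists2 k, subword (eta x) k (size w) = w & state m x k = u >]]%SET.

Lemma occurring_statesP x w u :
  reflect (exists2 k, subword (eta x) k (size w) = w & state m x k = u)
          (u \in occurring_states x w).
Proof. by rewrite inE; exact: asboolP. Qed.

Lemma occurring_states_infix x w1 w w2 :
  [set prefix_perm hp w1 u | u in occurring_states x (w1 ++ w ++ w2)]%SET
    \subset occurring_states x w.
Proof.
apply/fintype.subsetP => _ /imsetP[_ /occurring_statesP[k + <-] ->].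
rewrite !size_cat !subword_cat => /eqP.
rewrite !eqseq_cat ?size_mkseq // => /andP[/eqP e1 /andP[/eqP e2 _]].
apply/occurring_statesP; exists (k + (size w1)%:Z)%R => //.
by rewrite -[in RHS]e1 prefix_perm_subword.
Qed.

(** Extending a word, even to the left, does not increase the number of its
    states: prefix permutations are injective. *)
Lemma occurring_states_card_infix x w1 w w2 :
  (#|occurring_states x (w1 ++ w ++ w2)| <= #|occurring_states x w|)%N.
Proof.
rewrite -(card_imset _ (@perm_inj _ (prefix_perm hp w1))).
exact/subset_leq_card/occurring_states_infix.
Qed.

Lemma infix_of_long w0 : language Y w0 ->
  exists N, forall w, language Y w -> (N <= size w)%N -> infix w0 w.
Proof.
move=> /(uniform_recurrence Ysub.1 (subshift_invariant Ysub.2) Ymin)[N hN].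
exists (N + size w0)%N => w [y [k [Yy ->]]]; rewrite size_mkseq => le_w.
have [i iN ei] := hN y k Yy.
have -> : size w = (i + (size w0 + (size w - i - size w0)))%N by lia.
by rewrite !subword_cat ei infix_infix.
Qed.

Lemma exists_min_occurring_states x :
  exists w0, language Y w0 /\
    forall w, language Y w ->
      (#|occurring_states x w0| <= #|occurring_states x w|)%N.
Proof.
pose P c := `[< exists2 w, language Y w & #|occurring_states x w| = c >].
have [y Yy] := Ymin.1.
have exP : exists c, P c.
  exists #|occurring_states x [::]|; apply/asboolP; exists [::] => //.
  exact: (language_subword 0%R 0 Yy).
case: (ex_minnP exP) => c /asboolP[w0 Lw0 <-] minc; exists w0; split=> // w Lw.
by apply: minc; apply/asboolP; exists w.
Qed.

(** The set of states shared by all long words of the sequence is nonempty and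
    invariant under their return permutations, hence full; counting then makes
    the states of every word full. *)
Lemma nested_minimal (W : nat -> seq 'I_kappa) :
  (forall n, language Y (W n)) -> (forall n, prefix (W n) (W n.+1)) ->
  size (W n) @[n --> \oo] --> \oo ->
  (forall n, acts_transitively
     (\bigcup_(k in [set k | (n <= k)%N]) return_perms hp Y (W k))) ->
  minimal X.
Proof.
move=> LW preW sizeW trW; split.
  have [y Yy] := Ymin.1.
  have [x [ex _]] := sliding_block_code_lift hp y [tuple y 0%R | i < m].
  by exists x; rewrite /preimage /= ex.
move=> x Xx; pose occ := occurring_states x.
have [w0 [Lw0 minw0]] := exists_min_occurring_states x.
have [N hN] := infix_of_long Lw0.
have {hN} [n0 hn0] : exists n0, forall n, (n0 <= n)%N -> infix w0 (W n).
  have [] := iffLR (cvgnyPge _) sizeW N.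
  by move=> n0 _ h0; exists n0 => n /h0; exact: hN.
(* Past w0 all cardinals agree, so that the inclusions become equalities. *)
have occ_eq a w b : language Y (a ++ w ++ b) -> infix w0 w ->
    [set prefix_perm hp a t | t in occ (a ++ w ++ b)]%SET = occ w.
  move=> L /infixP[w1 [w2 ew]]; apply/eqP.
  rewrite eqEcard occurring_states_infix card_imset; last exact: perm_inj.
  by apply: leq_trans (minw0 _ L); rewrite ew;
    exact: occurring_states_card_infix.
have occ_prefix w b : language Y (w ++ b) -> infix w0 w -> occ (w ++ b) = occ w.
  move=> L iw; rewrite -(occ_eq [::] w b L iw).
  by rewrite (eq_imset _ (prefix_perm_nil hp)) imset_id.
have prefW (k : nat) : (n0 <= k)%N -> prefix (W n0) (W k).
  move/subnK <-; elim: (k - n0)%N => [|d IHd]; first exact: prefix_refl.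
  exact: prefix_trans IHd (preW _).
have occW (k : nat) : (n0 <= k)%N -> occ (W k) = occ (W n0).
  move=> le_k; have /prefixP[b eb] := prefW k le_k.
  by rewrite eb occ_prefix ?hn0 // -eb.
have full t : t \in occ (W n0).
  move: t; apply: (iffLR (acts_transitivelyP _ (state m x 0%R)) (trW n0)).
    have [k ek] := language_occurrence (LW n0) Xx.
    by exists (state m x k); apply/occurring_statesP; exists k.
  (* The states of the return wvw are those of w, and reading wv takes them to
     states of the second w. *)
  move=> _ t [k le_k [v Lv ->]]; rewrite -(occW k le_k) => tW.
  have iW := hn0 k le_k.
  rewrite -(occ_eq (W k ++ v) (W k) [::]) ?cats0 -?catA //.
  by apply: imset_f; rewrite -?catA occ_prefix.
have {}full w t : language Y w -> t \in occ w.
  move=> Lw; suff -> : occ w = [set: m.-tuple 'I_kappa]%SET by rewrite inE.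
  apply/eqP; rewrite eqEcard finset.subsetT /=.
  (* T(w0) is of least size and contains a permuted copy of the full T(W n0). *)
  apply: leq_trans (minw0 _ Lw).
  have /infixP[w1 [w2 ew]] := hn0 n0 (leqnn _).
  apply: leq_trans (occurring_states_card_infix x w1 w0 w2).
  by rewrite -ew; apply/subset_leq_card/fintype.subsetP => s _; exact: full.
move=> z Xz; apply/in_closure_orbit => k n.
have /occurring_statesP[j] :=
  full _ (state m z k) (language_subword k n (Xz : Y (eta z))).
rewrite size_mkseq => /(eq_subword_state hp) /[apply] e; exists j.
exact: eq_subword_le e.
Qed.

End ReturnPermutations.

Theorem theorem1p5 (kappa m : nat) (kappa_gt0 : (0 < kappa)%N)
    (h : block_code kappa m.+1) (hp : permutative h)
    (Y : set (fullshift kappa)) (Ysub : subshift Y) (Ymin : minimal Y) :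
  [<-> minimal (sliding_block_code h @^-1` Y);
       forall w : seq 'I_kappa, language Y w ->
         acts_transitively (return_perms hp Y w);
       exists w : nat -> seq 'I_kappa,
         [/\ forall n, language Y (w n),
             size (w n) @[n --> \oo] --> \oo &
             forall n, acts_transitively (return_perms hp Y (w n))];
       exists w : nat -> seq 'I_kappa,
         [/\ forall n, language Y (w n),
             forall n, prefix (w n) (w n.+1),
             size (w n) @[n --> \oo] --> \oo &
             forall n, acts_transitively
               (\bigcup_(k in [set k | (n <= k)%N]) return_perms hp Y (w k))]].
Proof.
have [y Yy] := Ymin.1.
have u : m.-tuple 'I_kappa := [tuple y 0%R | i < m].
have size_y : size (subword y 0%R n) @[n --> \oo] --> \oo.
  by apply/cvgnyPge => N; exists N => // n /=; rewrite size_mkseq.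
tfae.
- by move=> Xmin w; exact: minimal_transitive.
- move=> tr; exists (subword y 0%R).
  by split=> // n; last apply: tr; exact: language_subword.
- move=> [W [LW sizeW trW]].
  (* Long words contain w, which brings transitivity back to all words. *)
  have tr w : language Y w -> acts_transitively (return_perms hp Y w).
    move=> Lw; have [N hN] := infix_of_long Ysub Ymin Lw.
    have [n _ /(_ n (leqnn n)) le_n] := iffLR (cvgnyPge _) sizeW N.
    have /infixP[w1 [w2 ew]] := hN _ (LW n) le_n.
    by apply: (return_perms_infix u (w1 := w1) (w2 := w2)); rewrite -ew.
  exists (subword y 0%R); split=> // n; first exact: language_subword.
    by rewrite -addn1 subword_cat prefix_prefix.
  apply: (acts_transitively_sub u) (tr _ (language_subword 0%R n Yy)) => p Rp.
  by exists n => //=.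
- by move=> [W [LW preW sizeW trW]]; exact: nested_minimal trW.
Qed.
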